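(* Let $v,w\in S_n$ be such that there are no unexpected zeros. Then the set of connected components of $G_{v,w}$ with more than one vertex has the same cardinality as the set of coordinates in $D^\circ(v)$ having no elements of $D^\circ(v)$ in the same row west of them and none in the same column south of them, i.e. the set $$C_v=\{(i,j)\in D^\circ(v) : (i',j)\notin D^\circ(v)\ \forall i'>i,\ \text{ and } (i,j')\notin D^\circ(v)\ \forall j'<j\}.$$ Moreover, the number of isolated vertices of $G_{v,w}$ is the same as the cardinality of the set of $1$s on the antidiagonal of $v$ that do not share a row or column with $D^\circ(v)$, i.e. of the set $$A_v=\{i\in[n] : v(i)=n-i+1,\ \text{ and } (j,i)\notin D^\circ(v),\ (n-i+1,j)\notin D^\circ(v)\ \forall j\in[n]\}.$$
   Context: A permutation $v\in S_n$ is identified with the permutation matrix having $1$s at $(v(j),j)$. The opposite Rothe diagram is $D^\circ(v)=\{(i,j): v(j)<i,\ v^{-1}(i)>j\}$ (rows numbered from north to south, columns from west to east). $t_{a,b}$ is the transposition of $a$ and $b$; $t_{a,b}v$ (left multiplication) swaps the values $a$ and $b$ in the one-line notation of $v$. $\le$ denotes the Bruhat order on $S_n$. An unexpected zero for the pair $(v,w)$ is an $(i,j)\in D^\circ(v)$ such that $t_{v(j),i}\,v\not\le w$. The directed graph $G_{v,w}$ has vertex set $[n]$ and edges $v(j)\to i$ for all $(i,j)\in D^\circ(v)$ with $t_{v(j),i}\,v\le w$. Connected components of $G_{v,w}$ are those of the underlying undirected graph. *)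

(* Defs.v *)
From mathcomp Require Import all_boot all_fingroup.

Set Implicit Arguments.
Unset Strict Implicit.
Unset Printing Implicit Defensive.

(* [n] is encoded 0-based as 'I_n, so the antidiagonal position n - i + 1 of i
   is [rev_ord i].  A cell (i, j) is (row, column), rows numbered from north to
   south.  The product of 'S_n applies its left factor first:
   (s * t) x = t (s x). *)

(* t_{a,b} v in the usual right-to-left convention: swaps the values a and b
   in the one-line notation of v. *)
Definition swap_values n (a b : 'I_n) (v : 'S_n) : 'S_n := (v * tperm a b)%g.

(* Coxeter length on S_n. *)
Definition inv_number n (v : 'S_n) : nat :=
  #|[set p : 'I_n * 'I_n | (p.1 < p.2) && (v p.2 < v p.1)]|.

Definition bruhat_step n (u v : 'S_n) : bool :=
  [exists a, exists b, (v == swap_values a b u)] &&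
  (inv_number u < inv_number v).

(* The Bruhat order: reflexive transitive closure of u -> t u, for t a
   transposition with l(u) < l(t u). *)
Definition bruhat n (u v : 'S_n) : bool := connect (@bruhat_step n) u v.

Definition opp_rothe n (v : 'S_n) : {set 'I_n * 'I_n} :=
  [set p : 'I_n * 'I_n | (v p.2 < p.1) && (p.2 < (v^-1)%g p.1)].

Definition unexpected_zeros n (v w : 'S_n) : {set 'I_n * 'I_n} :=
  [set p in opp_rothe v | ~~ bruhat (swap_values (v p.2) p.1 v) w].

Definition G_edge n (v w : 'S_n) : rel 'I_n := fun a b =>
  [exists p in opp_rothe v,
    [&& bruhat (swap_values (v p.2) p.1 v) w, a == v p.2 & b == p.1]].

Definition G_adj n (v w : 'S_n) : rel 'I_n := fun a b =>
  G_edge v w a b || G_edge v w b a.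

Definition G_components n (v w : 'S_n) : {set {set 'I_n}} :=
  equivalence_partition (connect (G_adj v w)) [set: 'I_n].

Definition G_isolated n (v w : 'S_n) : {set 'I_n} :=
  [set a | [forall b, ~~ G_adj v w a b]].

Definition C_set n (v : 'S_n) : {set 'I_n * 'I_n} :=
  [set p in opp_rothe v |
    [forall i' : 'I_n, (p.1 < i') ==> ((i', p.2) \notin opp_rothe v)] &&
    [forall j' : 'I_n, (j' < p.2) ==> ((p.1, j') \notin opp_rothe v)]].

Definition A_set n (v : 'S_n) : {set 'I_n} :=
  [set i : 'I_n | (v i == rev_ord i) &&
    [forall j : 'I_n, ((j, i) \notin opp_rothe v) &&
                      ((rev_ord i, j) \notin opp_rothe v)]].

(* Main.v *)
Require Import Defs.
From mathcomp Require Import all_boot all_fingroup.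
From mathcomp Require Import zify.

(* Without unexpected zeros the edges of G_{v,w} are exactly the non-inversions
   of v.  A vertex x outside a component K either precedes all of K in position
   and exceeds it in value, or follows all of K and lies below it in value,
   because x cannot separate two adjacent vertices.  So the components are the
   blocks of the skew-sum decomposition of v.  A block with several elements
   corresponds to the cell of C_v whose column is the first position of the block
   and whose row is its largest value; a block with one element lies on the
   antidiagonal, by counting the values on each side of it. *)

Set Implicit Arguments.
Unset Strict Implicit.
Unset Printing Implicit Defensive.

Local Open Scope group_scope.

(** Relates values, the vertices of the graph; [v^-1] gives their positions. *)
Definition noninversion n (v : 'S_n) : rel 'I_n := fun a b =>
  ((a < b) && (v^-1 a < v^-1 b)) || ((b < a) && (v^-1 b < v^-1 a)).

Lemma noninversion_sym n (v : 'S_n) : symmetric (noninversion v).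
Proof. by move=> a b; rewrite /noninversion orbC. Qed.

Lemma connect_noninversion_sym n (v : 'S_n) :
  connect_sym (noninversion v).
Proof. exact/sym_connect_sym/noninversion_sym. Qed.

Lemma mem_opp_rothe n (v : 'S_n) (i j : 'I_n) :
  ((i, j) \in opp_rothe v) = (v j < i) && (j < v^-1 i).
Proof. by rewrite inE. Qed.

Lemma G_adj_noninversion n (v w : 'S_n) :
  unexpected_zeros v w = set0 -> G_adj v w =2 noninversion v.
Proof.
move=> uz0.
have edgeE a b : G_edge v w a b = (a < b) && (v^-1 a < v^-1 b).
  apply/exists_inP/idP => [[[i j]] /= + /and3P[_ /eqP-> /eqP->]|ltab].
    by rewrite mem_opp_rothe permK.
  (* The only cell that can yield the edge; it is not an unexpected zero. *)
  have Dba : (b, v^-1 a) \in opp_rothe v by rewrite mem_opp_rothe permKV.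
  exists (b, v^-1 a) => //=; rewrite permKV !eqxx !andbT.
  have := in_set0 (b, v^-1 a); rewrite -uz0 inE Dba /= permKV.
  by move/negbFE.
by move=> a b; rewrite /G_adj !edgeE.
Qed.

Lemma eq_val_permV n (v : 'S_n) (x y : 'I_n) :
  (v^-1 x == v^-1 y :> nat) = (x == y :> nat).
Proof. by rewrite !(inj_eq val_inj) (inj_eq perm_inj). Qed.

(** As [(b, j)] is itself a cell, one of the two inequalities defining a cell is automatic south of
    it and west of it. What remains is a cut: values placed before [j] exceed [b], the others do
    not. *)
Lemma C_setP n (v : 'S_n) (b j : 'I_n) :
  reflect [/\ v j < b, j < v^-1 b,
              forall x, v^-1 x < j -> b < x &
              forall x, j <= v^-1 x -> x <= b]
          ((b, j) \in C_set v).
Proof.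
rewrite inE mem_opp_rothe /=; apply: (iffP andP).
  case=> /andP[ltvjb ltjb] /andP[/forallP south /forallP west].
  split=> // x.
    move=> ltxj; have := west (v^-1 x); rewrite ltxj mem_opp_rothe permKV /=.
    have := eq_val_permV v x b; lia.
  move=> lejx; have := south x; rewrite mem_opp_rothe.
  have := eq_val_permV v (v j) x; rewrite permK; lia.
case=> ltvjb ltjb before after; split; first exact/andP.
apply/andP; split; apply/forallP => x; rewrite mem_opp_rothe; apply/implyP.
  by have := after x; lia.
by have := before (v x); rewrite permK; lia.
Qed.

(** No noninversion crosses the cut at [j']. If [j < j'], then [b > v j > b'] puts [b] before this
    cut, while [b'] lies after it. *)
Lemma C_set_component_le n (v : 'S_n) p q :
  p \in C_set v -> q \in C_set v ->
  connect (noninversion v) p.1 q.1 -> q.2 <= p.2.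
Proof.
case: p q => [b j] [b' j'] /C_setP[ltb ltj bef aft] /C_setP[ltb' ltj' bef' aft'] /=.
move=> conn; rewrite leqNgt; apply/negP => ltjj'.
have cl : closed (noninversion v) [pred x : 'I_n | j' <= v^-1 x].
  apply: intro_closed; first exact: connect_noninversion_sym.
  move=> x y; rewrite /noninversion !inE.
  have := bef' y; have := aft' x; lia.
have := closed_connect cl conn; rewrite !inE.
have := aft b'; have := aft' b; have := bef' (v j); rewrite permK.
lia.
Qed.

Lemma C_set_inj_component n (v : 'S_n) p q :
  p \in C_set v -> q \in C_set v ->
  connect (noninversion v) p.1 q.1 -> p = q.
Proof.
move=> Cp Cq conn; have le2 := C_set_component_le Cp Cq conn.
rewrite connect_noninversion_sym in conn.
have {}le2 := conj le2 (C_set_component_le Cq Cp conn).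
case: p q Cp Cq {conn} le2 => [b j] [b' j'] /= /C_setP[_ ltj _ aft].
move=> /C_setP[_ ltj' _ aft'] le2.
(* Once the columns agree, each row is the largest value from that position on. *)
have := aft b'; have := aft' b => h h'.
by congr (_, _); apply: val_inj => /=; lia.
Qed.

Lemma component_side n (v : 'S_n) (x y z : 'I_n) :
  ~~ connect (noninversion v) y x -> connect (noninversion v) y z ->
  ((v^-1 x < v^-1 y) && (y < x)) = ((v^-1 x < v^-1 z) && (z < x)).
Proof.
move=> nyx; case/connectP => p + ->.
elim: p y nyx => //= y' p IHp y nyx /andP[adj pth].
have ny'x : ~~ connect (noninversion v) y' x.
  by apply: contra nyx; apply/connect_trans/connect1.
(* If [x] lay on different sides of [y] and [y'], these two would form an inversion through [x]. *)
rewrite -(IHp y') //.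
have: ~~ noninversion v y x by apply: contra nyx; apply: connect1.
have: ~~ noninversion v y' x by apply: contra ny'x; apply: connect1.
have neyx : y <> x by move=> eqyx; rewrite eqyx connect0 in nyx.
have ney'x : y' <> x by move=> eqyx; rewrite eqyx connect0 in ny'x.
have := eq_val_permV v x y; have := eq_val_permV v x y'.
move: adj; rewrite /noninversion /=; lia.
Qed.

Lemma component_C_set n (v : 'S_n) (x y : 'I_n) :
  connect (noninversion v) x y -> x != y ->
  exists2 p, p \in C_set v & connect (noninversion v) x p.1.
Proof.
move=> cxy nexy; set e := connect (noninversion v).
have [a cxa mina] := @arg_minnP _ x (e x) (fun z => v^-1 z) (connect0 _ x).
have [b cxb maxb] := @arg_maxnP _ x (e x) (fun z => val z) (connect0 _ x).
exists (b, v^-1 a) => //=.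
have cab : e a b by apply: connect_trans cxb; rewrite connect_noninversion_sym.
(* If the first element were also the largest, it would form an inversion with every other member
   and have no neighbour. *)
have nab : a != b :> nat.
  apply/eqP => /val_inj eqab; move: mina maxb; rewrite -eqab => mina maxb.
  have [z caz neaz] : exists2 z, e a z & z != a.
    have [eqxa|nexa] := eqVneq x a; first by exists y; rewrite -?eqxa // eq_sym.
    by exists x => //; rewrite /e connect_noninversion_sym.
  case/connectP: caz neaz => [[|c p] /=]; first by move=> _ ->; rewrite eqxx.
  case/andP=> adj _ _ _.
  have cxc : e x c by apply: connect_trans cxa _; apply: connect1.
  have := mina c cxc; have := maxb c cxc.
  by move: adj; rewrite /noninversion /=; lia.
(* An outside vertex is on the same side of [a] and of [b], so the position bound from [a] combines
   with the value bound from [b]. *)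
have side z : ~~ e x z ->
    ((v^-1 z < v^-1 a) && (b < z)) || ((v^-1 a < v^-1 z) && (z < b)).
  move=> nxz.
  have naz : ~~ e a z by apply: contra nxz; apply: connect_trans.
  have nbz : ~~ e b z by apply: contra nxz; apply: connect_trans.
  have := component_side naz cab.
  have: ~~ noninversion v a z by apply: contra naz; apply: connect1.
  have: ~~ noninversion v b z by apply: contra nbz; apply: connect1.
  have neaz : a != z :> nat by apply: contraNneq naz => /val_inj->; apply: connect0.
  have nebz : b != z :> nat by apply: contraNneq nbz => /val_inj->; apply: connect0.
  have := eq_val_permV v a z; have := eq_val_permV v b z.
  rewrite /noninversion; have /= := mina b cxb; have /= := maxb a cxa.
  lia.
have := eq_val_permV v a b.
have := mina b cxb; have := maxb a cxa => /= h1 h2 h3.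
apply/C_setP; rewrite permKV; split; try lia.
  move=> z ltza; have := side z; have := mina z.
  by case: (e x z) => [/(_ isT)|_ /(_ isT)]; lia.
move=> z leaz; have := side z; have := maxb z.
by case: (e x z) => [/(_ isT)|_ /(_ isT)] /=; lia.
Qed.

Lemma isolated_antidiagonal n (v : 'S_n) (i : 'I_n) :
  (forall x, ~~ noninversion v (v i) x) -> v i = rev_ord i.
Proof.
move=> iso; apply: val_inj => /=.
(* Every other value forms an inversion with [v i]. *)
have isoE (x : 'I_n) : (x < i) = (v i < v x).
  have := iso (v x); rewrite /noninversion !permK.
  have := eq_val_permV v (v x) (v i); rewrite !permK.
  lia.
have card_lt m : m <= n -> #|[set x : 'I_n | x < m]| = m.
  move=> lemn; rewrite cardsE -sum1_card.
  by rewrite -(big_ord_widen _ (fun=> 1%N)) // sum1_card card_ord.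
have cardE : #|[set x : 'I_n | x < i]| = #|[set y : 'I_n | v i < y]|.
  rewrite -[RHS](card_preimset _ (@perm_inj _ v)).
  by apply: eq_card => x; rewrite !inE isoE.
(* The [v i + 1] values up to [v i] and the [i] values above it add up to [n]. *)
have := cardsC [set y : 'I_n | y < (v i).+1].
have -> : ~: [set y : 'I_n | y < (v i).+1] = [set y : 'I_n | v i < y].
  by apply/setP => y; rewrite !inE; lia.
rewrite -cardE !card_lt ?card_ord ?(ltnW (ltn_ord _)) //.
lia.
Qed.

Lemma mem_A_set n (v : 'S_n) (i : 'I_n) :
  (i \in A_set v) = [forall x, ~~ noninversion v (v i) x].
Proof.
rewrite inE; apply/andP/forallP => [[/eqP vi /forallP D0] x|iso].
  (* Column [i] excludes neighbours above [v i], row [v i] those below. *)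
  have := D0 x; have := D0 (v^-1 x).
  rewrite !mem_opp_rothe -vi permKV /noninversion !permK; lia.
have vi : v i = rev_ord i by apply: isolated_antidiagonal.
split; first exact/eqP.
apply/forallP => x; rewrite -vi !mem_opp_rothe.
have := iso x; have := iso (v x); rewrite /noninversion !permK; lia.
Qed.

Theorem theorem1p2 (n : nat) (v w : 'S_n) :
  unexpected_zeros v w = set0 ->
  #|[set C in G_components v w | 1 < #|C| ]| = #|C_set v| /\
  #|G_isolated v w| = #|A_set v|.
Proof.
move=> /G_adj_noninversion adjE; split; last first.
  (* Isolated vertices are values and [A_set] holds positions; [v] matches them. *)
  rewrite -(card_preimset _ (@perm_inj _ v)); apply: eq_card => i.
  rewrite mem_A_set !inE.
  by apply: eq_forallb => x; rewrite adjE.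
pose e := connect (noninversion v).
pose comp (x : 'I_n) := [set y in [set: 'I_n] | connect (G_adj v w) x y].
have mem_comp x y : (y \in comp x) = e x y.
  by rewrite !inE (eq_connect adjE).
have comp_inj : {in C_set v &, injective (fun p => comp p.1)}.
  move=> p q Cp Cq /setP/(_ q.1); rewrite !mem_comp /e connect0.
  exact: C_set_inj_component.
(* It remains to see that the components of the rows of [C_set] are exactly the nontrivial ones. *)
rewrite -(card_in_imset comp_inj).
apply: eq_card => K; rewrite inE; apply/andP/imsetP.
  case=> /imsetP[x _ ->] /card_gt1P[y [z [xy xz neyz]]].
  have {}xy : e x y by rewrite -mem_comp.
  have {}xz : e x z by rewrite -mem_comp.
  have cyz : e y z.
    by apply: connect_trans xz; rewrite connect_noninversion_sym.
  have [p Cp cyp] := component_C_set cyz neyz; exists p => //.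
  apply/setP => t; rewrite [LHS]mem_comp mem_comp.
  exact/same_connect/(connect_trans xy)/cyp/connect_noninversion_sym.
case=> -[b j] Cp ->; split; first by apply/imsetP; exists b.
(* The cell's own edge joins two distinct members. *)
case/C_setP: Cp => ltb ltj _ _; apply/card_gt1P; exists b, (v j) => /=.
rewrite !mem_comp /e connect0; split=> //; last by rewrite neq_ltn ltb orbT.
by apply: connect1; rewrite /noninversion permK ltb ltj orbT.
Qed.
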